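(* Let $0 < \epsilon < 1$ and $0 < \gamma_3 < \gamma_4 < \gamma_5 < \gamma_4 + \epsilon(\gamma_4 - \gamma_3)$. Then there exists $r_0$ such that for every integer $r \ge r_0$ and every $V > 0$ there exists $N_0 \in \mathbb{N}$ with the following property: for all $N \ge N_0$ and every tree $\Gamma$ of height $N$ with $\mathcal{H}^{\gamma_4}_r(\Gamma) \ge V$ in which every node has at most $r^{\gamma_5}$ children, there exists a subtree $\Gamma'$ of $\Gamma$ such that every node $Q \in \Gamma'$ of height at least $N_0$ has $(r^{\gamma_3}, 1-\epsilon)$-fertile ancestry in $\Gamma'$.
   Context: A tree of height $N\in\mathbb{N}_0$ is a finite set $\Gamma$ of nodes with a partition $\Gamma = \Gamma_0 \cup \cdots \cup \Gamma_N$, $|\Gamma_0| = 1$ (the root), and a parent function $P\colon \Gamma\setminus\Gamma_0 \to \Gamma\setminus\Gamma_N$ with $P(\Gamma_n) = \Gamma_{n-1}$ for $1 \le n \le N$. Nodes in $\Gamma_n$ have height $n$; nodes in $\Gamma_N$ are leaves; the children of $Q$ are $C_\Gamma(Q) = P^{-1}(Q)$. A subtree of $\Gamma$ is a tree $\Gamma'\subseteq\Gamma$ of the same height as $\Gamma$ (with levels $\Gamma'\cap\Gamma_n$) whose parent function is the restriction of $P$. The ancestry of $Q \in \Gamma_n$ is $\mathcal{A}_\Gamma(Q) = \{P^k(Q) : 1 \le k \le n\}$. A node is $c$-fertile in $\Gamma$ if $|C_\Gamma(Q)| \ge c$; $\mathcal{F}_{\Gamma,c}(Q)$ is the set of $c$-fertile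 elements of $\mathcal{A}_\Gamma(Q)$; and $Q$ has $(c,\omega)$-fertile ancestry in $\Gamma$ if $|\mathcal{F}_{\Gamma,c}(Q)| \ge \omega|\mathcal{A}_\Gamma(Q)|$. A cut of $\Gamma$ is a set $\mathcal{C}\subseteq\Gamma$ such that for every leaf $L$, $(\{L\}\cup\mathcal{A}_\Gamma(L))\cap\mathcal{C}\neq\emptyset$. The $\gamma$-Hausdorff content of $\Gamma$ with base $r$ is $\mathcal{H}^\gamma_r(\Gamma) = \min\{\sum_{Q\in\mathcal{C}} r^{-\mathrm{height}(Q)\gamma} : \mathcal{C} \text{ a cut of } \Gamma\}$. *)

(* Defs.v *)
From HB Require Import structures.
From mathcomp Require Import all_boot all_order all_algebra.
From mathcomp Require Import reals exp.

Set Implicit Arguments.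
Unset Strict Implicit.
Unset Printing Implicit Defensive.

Import Order.TTheory GRing.Theory Num.Theory.
Local Open Scope ring_scope.

(* The nodes are a subset of an ambient finite type, so that a tree and its
   subtrees share one type of nodes.  The partition into levels is encoded by
   [height]; only the values of [height] on [nodes] and of [parent] on the
   nodes of positive height are meaningful.  Nonemptiness of every level
   follows from [card_root] and [parent_level]. *)
Record tree (T : finType) (N : nat) := Tree {
  nodes : {set T};
  height : T -> nat;
  parent : T -> T;
  height_le : forall Q, Q \in nodes -> (height Q <= N)%N;
  card_root : #|[set Q in nodes | height Q == 0%N]| = 1%N;
  parent_level : forall n, (1 <= n <= N)%N ->
    [set parent Q | Q in [set Q in nodes | height Q == n]]
      = [set Q in nodes | height Q == n.-1]
}.

Section Tree.
Variables (T : finType) (N : nat).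
Implicit Types (G : tree T N) (Q L : T) (C : {set T}).

Definition level G (n : nat) : {set T} := [set Q in nodes G | height G Q == n].

Definition leaves G : {set T} := level G N.

Definition children G Q : {set T} :=
  [set Q' in nodes G | (0 < height G Q')%N && (parent G Q' == Q)].

Definition subtree G' G : Prop :=
  [/\ nodes G' \subset nodes G,
      forall n, level G' n = nodes G' :&: level G n
    & forall Q, Q \in nodes G' -> (0 < height G' Q)%N ->
        parent G' Q = parent G Q].

(* The exponent is shifted: [k : 'I_n] stands for the k.+1-st ancestor. *)
Definition ancestry G Q : {set T} :=
  [set iter k.+1 (parent G) Q | k : 'I_(height G Q)].

Definition cut G C : bool :=
  (C \subset nodes G) &&
  [forall L in leaves G, (L |: ancestry G L) :&: C != set0].

Lemma cut_nodes G : cut G (nodes G).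
Proof.
rewrite /cut subxx /=; apply/forall_inP => L; rewrite inE => /andP[LG _].
by apply/set0Pn; exists L; rewrite !inE eqxx.
Qed.

Section Real.
Variable R : realType.
Implicit Types (c w r g : R).

Definition fertile G c Q : bool := c <= #|children G Q|%:R.

Definition fertile_ancestors G c Q : {set T} :=
  [set A in ancestry G Q | fertile G c A].

Definition has_fertile_ancestry G c w Q : Prop :=
  w * #|ancestry G Q|%:R <= #|fertile_ancestors G c Q|%:R.

Definition cut_weight G r g C : R :=
  \sum_(Q in C) r `^ (- (height G Q)%:R * g).

(* A genuine minimum, since [nodes G] is a cut: see [hausdorff_content_min]. *)
Definition hausdorff_content G r g : R :=
  cut_weight G r g [arg min_(C < nodes G | cut G C) cut_weight G r g C]%O.

Lemma hausdorff_content_min G r g :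
  (exists2 C, cut G C & hausdorff_content G r g = cut_weight G r g C) /\
  (forall C, cut G C -> hausdorff_content G r g <= cut_weight G r g C).
Proof.
rewrite /hausdorff_content; case: arg_minP => [|C cutC minC].
  exact: cut_nodes.
by split; [exists C|].
Qed.

End Real.
End Tree.

(* Main.v *)
(* Let [h Q] be the content of the tree of descendants of [Q], normalized so that
   [Q] has weight 1.  Then [h <= 1], [h] of the root is at least the content of
   the tree, and [h Q * r^g4] is at most the sum of [h] over the children of [Q].
   As there are at most [r^g5] children, either at least [r^g3] of them satisfy
   [h Q' >= r^(g4-g5) h Q / 2], and we keep those, or some child satisfies
   [h Q' >= r^(g4-g3) h Q / 2], and we keep only that one.  Along a path in the
   resulting subtree every infertile step multiplies [h] by a large factor and
   every fertile step loses only a smaller one; since [h <= 1], this forces the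
   proportion of infertile steps below [eps]. *)

Require Import Defs.
From HB Require Import structures.
From mathcomp Require Import all_boot all_order all_algebra.
From mathcomp Require Import reals sequences exp.
From mathcomp Require Import zify ring lra.

Import Order.TTheory GRing.Theory Num.Theory.
Local Open Scope ring_scope.

Lemma sum_bigcup_le (R : numDomainType) (I T : finType) (A : {pred I})
    (F : I -> {set T}) (w : T -> R) : (forall x, 0 <= w x) ->
  \sum_(x in \bigcup_(i in A) F i) w x <= \sum_(i in A) \sum_(x in F i) w x.
Proof.
move=> w0; rewrite (exchange_big_dep (mem (\bigcup_(i in A) F i))) /=; last first.
  by move=> i x iA xF; apply/bigcupP; exists i.
apply: ler_sum => x /bigcupP[i iA xF].
by rewrite (bigD1 i) ?iA //= lerDl sumr_ge0.
Qed.

(** * Parents, ancestries and children in a tree *)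

Section TreeFacts.
Context {T : finType} {N : nat}.
Implicit Types (G : tree T N) (Q : T).

Lemma parent_nodes G Q : Q \in nodes G -> (0 < height G Q)%N ->
  parent G Q \in nodes G /\ height G (parent G Q) = (height G Q).-1.
Proof.
move=> QG Q0; have := parent_level G (n := height G Q).
rewrite Q0 height_le // => /(_ isT)/setP/(_ (parent G Q)).
rewrite imset_f ?inE ?QG ?eqxx //= => /esym/andP[-> /eqP ->]; by split.
Qed.

Lemma mem_children G Q Q' : Q' \in children G Q ->
  [/\ Q' \in nodes G, parent G Q' = Q, Q \in nodes G
    & height G Q' = (height G Q).+1].
Proof.
rewrite inE => /and3P[QG Q0 /eqP <-]; have [? ->] := parent_nodes G Q' QG Q0.
by split=> //; rewrite prednK.
Qed.

Lemma children_neq0 G Q : Q \in nodes G -> (height G Q < N)%N ->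
  exists Q', Q' \in children G Q.
Proof.
move=> QG QN; have := parent_level G (n := (height G Q).+1) QN.
move=> /setP/(_ Q); rewrite !inE QG eqxx => /imsetP[Q' + QE].
by rewrite inE => /andP[Q'G /eqP h]; exists Q'; rewrite inE Q'G h -QE eqxx.
Qed.

Lemma iter_parent G Q k : Q \in nodes G -> (k <= height G Q)%N ->
  iter k (parent G) Q \in nodes G /\
  height G (iter k (parent G) Q) = (height G Q - k)%N.
Proof.
move=> QG; elim: k => [|k IH] kQ; first by rewrite subn0.
have [kG kh] := IH (ltnW kQ).
by rewrite iterS subnS -kh; apply: parent_nodes; rewrite // kh subn_gt0.
Qed.

Lemma ancestry_root G Q : height G Q = 0%N -> ancestry G Q = set0.
Proof.
move=> h0; apply/setP => A; rewrite inE; apply/negP => /imsetP[[k +] _ _].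
by rewrite h0.
Qed.

Lemma ancestry_parent G Q : Q \in nodes G -> (0 < height G Q)%N ->
  ancestry G Q = parent G Q |: ancestry G (parent G Q).
Proof.
move=> QG Q0; have [PG Ph] := parent_nodes G Q QG Q0.
apply/setP => A; rewrite !inE; apply/imsetP/orP.
  move=> [[[|k] kQ] _ ->] /=; first by left.
  right; have kP : (k < height G (parent G Q))%N by rewrite Ph -ltnS prednK.
  by apply/imsetP; exists (Ordinal kP) => //=; rewrite -iterSr.
move=> [/eqP ->|/imsetP[[k kP] _ ->]]; first by exists (Ordinal Q0).
have kQ : (k.+1 < height G Q)%N by rewrite -(prednK Q0) ltnS -Ph.
by exists (Ordinal kQ) => //=; rewrite -iterSr.
Qed.

Lemma parent_notin_ancestry G Q : Q \in nodes G -> (0 < height G Q)%N ->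
  parent G Q \notin ancestry G (parent G Q).
Proof.
move=> QG Q0; have [PG Ph] := parent_nodes G Q QG Q0.
apply/negP => /imsetP[[k kP] _ /= /(congr1 (height G))].
rewrite -iterS; have [_ ->] := iter_parent G _ k.+1 PG kP.
by move=> /eqP; rewrite eqn_leq subnS => /andP[+ _]; lia.
Qed.

Lemma card_ancestry G Q : Q \in nodes G -> #|ancestry G Q| = height G Q.
Proof.
move hE : (height G Q) => h; elim: h Q hE => [|h IH] Q hE QG.
  by rewrite ancestry_root // cards0.
have Q0 : (0 < height G Q)%N by rewrite hE.
have [PG Ph] := parent_nodes G Q QG Q0.
rewrite ancestry_parent // cardsU1 parent_notin_ancestry // IH //.
by rewrite Ph hE.
Qed.

(** The recursion behind the induction on height: passing from a node to its parent removes exactly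
    that parent from the ancestry, so the count changes by one or not at all. *)
Lemma card_fertile_ancestors (R : realType) G (c : R) Q :
  Q \in nodes G -> (0 < height G Q)%N ->
  #|fertile_ancestors G c Q| =
    (fertile G c (parent G Q) + #|fertile_ancestors G c (parent G Q)|)%N.
Proof.
move=> QG Q0.
rewrite /fertile_ancestors ancestry_parent //.
have /negPf nP := parent_notin_ancestry G Q QG Q0.
have [Pf|Pf] := boolP (fertile G c (parent G Q)).
  transitivity #|parent G Q |: fertile_ancestors G c (parent G Q)|; last first.
    by rewrite cardsU1 inE nP.
  apply: eq_card => A.
  by rewrite !inE; case: eqVneq => // ->; rewrite Pf.
rewrite add0n; apply: eq_card => A; rewrite !inE.
by case: eqVneq => // ->; rewrite (negPf Pf) !andbF.
Qed.

End TreeFacts.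

(** * The subtree cut out by a choice of children at every node *)

Section Selection.
Context {T : finType} {N : nat} (G : tree T N) (S : T -> {set T}).
Hypothesis subS : forall Q, Q \in nodes G -> (height G Q < N)%N ->
  S Q \subset children G Q.
Hypothesis S0 : forall Q, Q \in nodes G -> (height G Q < N)%N -> S Q != set0.

(** The nodes reached from the root through chosen children only, written as a condition on the
    whole path upwards; [selected_parent] gives the recursive form. *)
Definition selected_nodes : {set T} :=
  [set Q in nodes G | [forall j : 'I_(height G Q),
     iter j (parent G) Q \in S (iter j.+1 (parent G) Q)]].

Lemma selected_parent Q : Q \in nodes G -> (0 < height G Q)%N ->
  (Q \in selected_nodes) =
    (Q \in S (parent G Q)) && (parent G Q \in selected_nodes).
Proof.
move=> QG Q0; have [PG Ph] := parent_nodes G Q QG Q0.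
rewrite !inE QG PG /=; apply/forallP/andP.
  move=> sel; split; first exact: (sel (Ordinal Q0)).
  apply/forallP => -[k kP].
  have kQ : (k.+1 < height G Q)%N by rewrite -(prednK Q0) ltnS -Ph.
  by have := sel (Ordinal kQ); rewrite /= -!iterSr.
move=> [QS /forallP sel] [[|k] kQ] //=.
have kP : (k < height G (parent G Q))%N by rewrite Ph -ltnS prednK.
by have := sel (Ordinal kP); rewrite /= -iterS -!iterSr.
Qed.

Fact selected_height_le Q : Q \in selected_nodes -> (height G Q <= N)%N.
Proof. by rewrite inE => /andP[/height_le]. Qed.

Fact selected_card_root : #|[set Q in selected_nodes | height G Q == 0%N]| = 1%N.
Proof.
rewrite -(card_root G); apply: eq_card => Q; rewrite !inE.
case: eqP; rewrite ?andbF // => h0; rewrite !andbT.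
by rewrite andb_idr // => _; apply/forallP => -[k +]; rewrite h0.
Qed.

(** Choices are nonempty below height [N], so every selected node there keeps a selected child and
    no branch stops early. *)
Fact selected_parent_level n : (1 <= n <= N)%N ->
  [set parent G Q | Q in [set Q in selected_nodes | height G Q == n]]
    = [set Q in selected_nodes | height G Q == n.-1].
Proof.
move=> /andP[n0 nN]; apply/setP => Q; apply/imsetP/idP.
  move=> [Q' + ->]; rewrite inE => /andP[sQ' /eqP hQ'].
  have Q'G : Q' \in nodes G by move: sQ'; rewrite inE => /andP[].
  have Q'0 : (0 < height G Q')%N by rewrite hQ'.
  have [_ Ph] := parent_nodes G Q' Q'G Q'0.
  by rewrite inE Ph hQ' eqxx andbT; move: sQ'; rewrite selected_parent // => /andP[].
rewrite inE => /andP[sQ /eqP hQ].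
have QG : Q \in nodes G by move: sQ; rewrite inE => /andP[].
have QN : (height G Q < N)%N by rewrite hQ prednK.
have /set0Pn[Q' Q'S] := S0 Q QG QN.
have [Q'G PQ' _ hQ'] := mem_children G Q Q' (subsetP (subS Q QG QN) _ Q'S).
exists Q'; last by rewrite PQ'.
by rewrite inE selected_parent ?hQ' // PQ' Q'S sQ hQ prednK ?eqxx.
Qed.

Definition selected_tree : tree T N :=
  Tree selected_height_le selected_card_root selected_parent_level.

Lemma subtree_selected : subtree selected_tree G.
Proof.
split=> [|n|//]; first by apply/subsetP => Q; rewrite inE => /andP[].
by apply/setP => Q; rewrite !inE /=; case: (Q \in nodes G).
Qed.

Lemma children_selected Q : Q \in selected_nodes -> (height G Q < N)%N ->
  children selected_tree Q = S Q.
Proof.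
move=> sQ QN; have QG : Q \in nodes G by move: sQ; rewrite inE => /andP[].
apply/setP => Q'; rewrite [LHS]inE /=; apply/and3P/idP.
  move=> [sQ' Q'0 /eqP PQ'].
  have Q'G : Q' \in nodes G by move: sQ'; rewrite inE => /andP[].
  by move: sQ'; rewrite selected_parent // PQ' => /andP[].
move=> Q'S; have [Q'G PQ' _ hQ'] := mem_children G Q Q' (subsetP (subS Q QG QN) _ Q'S).
by rewrite selected_parent ?hQ' // PQ' Q'S sQ eqxx.
Qed.

(** Induction on the height: a step down from a fertile node costs a factor [d], from an infertile
    one a factor [k], and [a] counts the former. The bound on [a] keeps the truncated subtraction in
    the exponent of [k] exact. *)
Lemma selected_tree_bound {R : realType} (f : T -> R) (c d k V : R) :
  0 <= d -> 0 <= k ->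
  (forall Q, Q \in nodes G -> height G Q = 0%N -> V <= f Q) ->
  (forall Q, Q \in nodes G -> (height G Q < N)%N ->
    (c <= #|S Q|%:R -> {in S Q, forall Q', f Q * d <= f Q'}) /\
    (#|S Q|%:R < c -> {in S Q, forall Q', f Q * k <= f Q'})) ->
  forall Q, Q \in selected_nodes ->
  let a := #|fertile_ancestors selected_tree c Q| in
  (a <= height G Q)%N /\ V * d ^+ a * k ^+ (height G Q - a) <= f Q.
Proof.
move=> d0 k0 fV fS Q; move hE : (height G Q) => h; elim: h Q hE => [|h IH] Q hE sQ /=.
  have QG : Q \in nodes G by move: sQ; rewrite inE => /andP[].
  have -> : #|fertile_ancestors selected_tree c Q| = 0%N.
    by rewrite /fertile_ancestors ancestry_root //; apply: eq_card0 => A; rewrite !inE.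
  by split=> //; rewrite !mulr1; apply: fV.
have QG : Q \in nodes G by move: sQ; rewrite inE => /andP[].
have Q0 : (0 < height G Q)%N by rewrite hE.
have [PG Ph] := parent_nodes G Q QG Q0.
have PN : (height G (parent G Q) < N)%N by rewrite Ph prednK ?height_le.
move: (sQ); rewrite selected_parent // => /andP[QS sP].
have /= [|ah IHP] := IH _ _ sP; first by rewrite Ph hE.
rewrite (card_fertile_ancestors _ selected_tree) //= /fertile children_selected //.
have [fertS infertS] := fS _ PG PN.
set a := #|fertile_ancestors selected_tree c (parent G Q)| in ah IHP *.
have [cS|Sc] := leP c #|S (parent G Q)|%:R.
  split; first by rewrite ltnS.
  apply: le_trans (fertS cS Q QS); apply: le_trans (ler_wpM2r d0 IHP).
  by rewrite add1n subSS exprSr mulrA [X in _ <= X]mulrAC.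
split; first by rewrite add0n ltnW.
apply: le_trans (infertS Sc Q QS); apply: le_trans (ler_wpM2r k0 IHP).
by rewrite add0n subSn // exprSr mulrA.
Qed.

End Selection.

(** * Normalized content of the descendants of a node *)

Section NodeContent.
Context {R : realType} {T : finType} {N : nat} (G : tree T N) (r g : R).
Hypothesis r0 : 0 < r.

(* The content of the subtree of descendants of [Q], rescaled so that [Q]
   itself has weight 1; [k] is the distance from [Q] to the leaves. *)
Fixpoint node_content (k : nat) (Q : T) : R :=
  if k is k'.+1 then
    Num.min 1 (r `^ (- g) * \sum_(Q' in children G Q) node_content k' Q')
  else 1.

Lemma node_content_le1 k Q : node_content k Q <= 1.
Proof. by case: k => //= k; rewrite ge_min lexx. Qed.

Lemma node_content_ge0 k Q : 0 <= node_content k Q.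
Proof.
elim: k Q => //= k IH Q; rewrite le_min ler01 mulr_ge0 ?powR_ge0 //.
exact: sumr_ge0.
Qed.

Lemma node_content_children k Q :
  node_content k.+1 Q * r `^ g <= \sum_(Q' in children G Q) node_content k Q'.
Proof.
apply: (@le_trans _ _ (r `^ (- g) * (\sum_(Q' in children G Q) node_content k Q') * r `^ g)).
  by rewrite ler_wpM2r ?powR_ge0 //= ge_min lexx orbT.
by rewrite mulrAC powRN mulVf ?mul1r // gt_eqF ?powR_gt0.
Qed.

(** The recursion is realized by a cut of the descendants of [Q]: where the minimum is 1, take [Q]
    alone; otherwise unite the cuts obtained for its children. *)
Lemma node_content_cut k Q : Q \in nodes G -> (height G Q + k)%N = N ->
  exists C : {set T}, [/\ C \subset nodes G,
    forall L, L \in leaves G -> iter k (parent G) L = Q ->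
      exists2 j, (j <= k)%N & iter j (parent G) L \in C
    & cut_weight G r g C <= r `^ (- (height G Q)%:R * g) * node_content k Q].
Proof.
have single k' Q' : Q' \in nodes G -> [/\ [set Q'] \subset nodes G,
    forall L, L \in leaves G -> iter k' (parent G) L = Q' ->
      exists2 j, (j <= k')%N & iter j (parent G) L \in [set Q']
    & cut_weight G r g [set Q'] <= r `^ (- (height G Q')%:R * g) * 1].
  move=> Q'G; split; first by rewrite sub1set.
    by move=> L _ <-; exists k'; rewrite ?set11.
  by rewrite /cut_weight big_set1 mulr1.
elim: k Q => [|k IH] Q QG hQ; first by exists [set Q]; apply: single.
have [le1|gt1] := leP 1 (r `^ (- g) * \sum_(Q' in children G Q) node_content k Q').
  have E : node_content k.+1 Q = 1 by rewrite /= min_l.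
  by exists [set Q]; rewrite E; apply: single.
(* Membership is a premise inside the existential, so that [F] is total; [set0] is a default away
   from the children. *)
have /fin_all_exists[F FP] Q' : exists C : {set T}, Q' \in children G Q ->
  [/\ C \subset nodes G,
    forall L, L \in leaves G -> iter k (parent G) L = Q' ->
      exists2 j, (j <= k)%N & iter j (parent G) L \in C
    & cut_weight G r g C <= r `^ (- (height G Q')%:R * g) * node_content k Q'].
  have [Q'Q|_] := boolP (Q' \in children G Q); last by exists set0.
  have [Q'G _ _ hQ'] := mem_children _ _ _ Q'Q.
  have [|C CP] := IH Q' Q'G; first by rewrite hQ' addSnnS.
  by exists C.
exists (\bigcup_(Q' in children G Q) F Q'); split.
- by apply/bigcupsP => Q' /FP[].
- move=> L LG LQ; have := LG; rewrite inE => /andP[LN /eqP hL].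
  have hk : (k < height G L)%N by rewrite hL -hQ addnS ltnS leq_addl.
  have [kG hkE] := iter_parent G L k LN (ltnW hk).
  have kQ : iter k (parent G) L \in children G Q.
    by rewrite inE kG hkE subn_gt0 hk -LQ -iterS eqxx.
  have [_ /(_ L LG erefl)[j jk jF] _] := FP _ kQ.
  by exists j; [exact: leqW | apply/bigcupP; exists (iter k (parent G) L)].
rewrite /= min_r ?(ltW gt1) // mulrA mulr_sumr.
apply: (@le_trans _ _ (\sum_(Q' in children G Q) cut_weight G r g (F Q'))).
  by apply: sum_bigcup_le => Q'; apply: powR_ge0.
apply: ler_sum => Q' Q'Q; have [_ _ w] := FP _ Q'Q; apply: le_trans w _.
have [_ _ _ ->] := mem_children _ _ _ Q'Q.
(* The factor [r^(-g)] of the recursion accounts for the children being one level deeper. *)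
rewrite ler_wpM2r ?node_content_ge0 // -powRD ?(gt_eqF r0) ?implybT //.
rewrite -natr1 [X in _ `^ X](_ : _ = - (height G Q)%:R * g - g) //; ring.
Qed.

Lemma content_le_node_content Q : Q \in nodes G -> height G Q = 0%N ->
  hausdorff_content G r g <= node_content N Q.
Proof.
move=> QG hQ; have [|C [CG Ccut Cw]] := node_content_cut N Q QG; first by rewrite hQ.
move: Cw; rewrite hQ oppr0 mul0r powRr0 mul1r; apply: le_trans.
have [_ min] := hausdorff_content_min G r g; apply: min.
rewrite /Defs.cut CG; apply/forall_inP => L LG.
have := LG; rewrite inE => /andP[LN /eqP hL].
have [NG hN] := iter_parent G L N LN (eq_leq (esym hL)).
(* The [N]-th ancestor of a leaf has height 0 and the root is unique, so a cut of the descendants of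
   [Q] is a cut of the whole tree. *)
have NQ : iter N (parent G) L = Q.
  have /eqP/cards1P[Q0 /setP E] := card_root G.
  have := E (iter N (parent G) L); rewrite !inE NG hN hL subnn => /esym/eqP ->.
  by have := E Q; rewrite !inE QG hQ => /esym/eqP.
(* Zero steps give the leaf itself; [j.+1] steps match the shifted index in [ancestry]. *)
have [[|j] jN jC] := Ccut L LG NQ; apply/set0Pn.
  by exists L; rewrite !inE eqxx.
exists (iter j.+1 (parent G) L); rewrite inE jC andbT inE; apply/orP; right.
by rewrite -hL in jN; apply/imsetP; exists (Ordinal jN).
Qed.

End NodeContent.

(** * The dichotomy at one node and the count along a path *)

(* If few members of [K] have [f] at least [d * h], the others contribute at most half
   of the sum, so the few share the other half. *)
Lemma many_large_or_one_larger (R : realFieldType) (T : finType) (K : {set T})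
    (f : T -> R) (b m c h d k : R) :
  (forall x, 0 <= f x) -> K != set0 -> 0 <= h -> 0 <= d -> 1 < c ->
  #|K|%:R <= m -> m * d = b / 2 -> c * k = b / 2 ->
  h * b <= \sum_(x in K) f x ->
  exists S : {set T}, [/\ S \subset K, S != set0,
    c <= #|S|%:R -> {in S, forall x, h * d <= f x}
    & #|S|%:R < c -> {in S, forall x, h * k <= f x}].
Proof.
move=> f0 /set0Pn[x0 x0K] h0 d0 c1 Km md ck sumK.
pose A := [set x in K | h * d <= f x].
have [cA|Ac] := leP c #|A|%:R.
  exists A; split=> //.
  - by apply/subsetP => x; rewrite inE => /andP[].
  - by apply/negP => /eqP A0; move: cA; rewrite A0 cards0; lra.
  - by move=> _ x; rewrite inE => /andP[].
  - by rewrite ltNge cA.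
(* Keep only a maximizer [y]. Since [1 < c], a singleton is never fertile, and fewer than [c]
   values, each at most [f y], must carry half of [h * b]. *)
case: (arg_maxP f x0K) => y yK ymax; exists [set y]; split.
- by rewrite sub1set.
- by apply/set0Pn; exists y; rewrite inE.
- by rewrite cards1; lra.
move=> _ x /set1P ->; have c0 : 0 < c by lra.
rewrite -(ler_pM2l c0) mulrCA ck.
have sumA : \sum_(x in A) f x <= c * f y.
  apply: (@le_trans _ _ (\sum_(x in A) f y)).
    by apply: ler_sum => z; rewrite inE => /andP[/ymax].
  by rewrite sumr_const -mulr_natl ler_wpM2r // ltW.
have sumD : \sum_(x in K :\: A) f x <= h * (b / 2).
  apply: (@le_trans _ _ (\sum_(x in K :\: A) h * d)).
    by apply: ler_sum => z; rewrite !inE => /andP[+ zK]; rewrite zK /= -ltNge => /ltW.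
  rewrite sumr_const -md -[_ *+ #|_|]mulr_natl mulrCA ler_wpM2l ?ler_wpM2r //.
  by apply: le_trans Km; rewrite ler_nat subset_leq_card ?subsetDl.
move: sumK; rewrite (big_setID A) /= setIC (setIidPl _); last first.
  by apply/subsetP => z; rewrite inE => /andP[].
lra.
Qed.

(* [y] of [x] steps each multiply a quantity of logarithm [v] by [r^(g4-g5)/2],
   the other [x - y] by [r^(g4-g3)/2], where [L = ln r] and [D = ln 2]. *)
Lemma fertile_density {R : realFieldType} {eps g3 g4 g5 L D v x y : R} :
  0 <= eps -> g3 < g4 -> g4 < g5 -> 0 <= x -> 0 < L ->
  D + 1 <= L * (g4 + eps * (g4 - g3) - g5) -> - v < x ->
  v + y * ((g4 - g5) * L - D) + (x - y) * ((g4 - g3) * L - D) <= 0 ->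
  (1 - eps) * x <= y.
Proof.
move=> eps0 hg34 hg45 x0 L0 hL xv bound; rewrite leNgt; apply/negP => yx.
(* Regrouped, [bound] says that [v + x * ((g4 - g5) * L - D) + (x - y) * (g5 - g3) * L] is at most
   0. The next three inequalities replace [x - y] by [eps * x], then [g5] by [g4] in the last term,
   and leave [v + x <= 0], against [xv]. *)
have h1 : eps * x * ((g5 - g3) * L) <= (x - y) * ((g5 - g3) * L).
  by apply: ler_wpM2r; [apply: mulr_ge0; lra | lra].
have h2 : eps * x * ((g4 - g3) * L) <= eps * x * ((g5 - g3) * L).
  by apply: ler_wpM2l; [apply: mulr_ge0 | apply: ler_wpM2r; lra].
have h3 : x * (D + 1) <= x * (L * (g4 + eps * (g4 - g3) - g5)).
  by rewrite ler_wpM2l.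
lra.
Qed.

Theorem theorem4p7 (R : realType) (eps g3 g4 g5 : R)
  (heps : 0 < eps < 1)
  (hg3 : 0 < g3) (hg34 : g3 < g4) (hg45 : g4 < g5)
  (hg5 : g5 < g4 + eps * (g4 - g3)) :
  exists r0 : nat, forall r : nat, (r0 <= r)%N ->
  forall V : R, 0 < V ->
  exists2 N0 : nat, (0 < N0)%N &
  forall N : nat, (N0 <= N)%N ->
  forall (T : finType) (G : tree T N),
    V <= hausdorff_content G r%:R g4 ->
    (forall Q : T, Q \in nodes G -> #|children G Q|%:R <= r%:R `^ g5) ->
    exists2 G' : tree T N, subtree G' G &
      forall Q : T, Q \in nodes G' -> (N0 <= height G' Q)%N ->
        has_fertile_ancestry G' (r%:R `^ g3) (1 - eps) Q.
Proof.
have /andP[eps0 _] := heps.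
pose theta := g4 + eps * (g4 - g3) - g5.
have theta0 : 0 < theta by rewrite /theta; lra.
have ln2 : 0 < ln (2 : R) by rewrite ln_gt0 // ltr1n.
(* This makes [ln r * theta] at least [ln 2 + 1]: the slack [theta] in the exponents pays for the
   factor 1/2 lost at each step and leaves one unit of logarithm per step. *)
exists (Num.bound (expR ((ln 2 + 1) / theta))) => r r_ge V V0.
have r_gt : expR ((ln 2 + 1) / theta) < r%:R.
  by apply: lt_le_trans (archi_boundP (expR_ge0 _)) _; rewrite ler_nat.
have r0 : 0 < r%:R :> R by apply: lt_trans (expR_gt0 _) r_gt.
have rV0 : r%:R != 0 :> R by rewrite gt_eqF.
set L := ln (r%:R : R).
have hL : ln 2 + 1 <= L * theta.
  rewrite -ler_pdivrMr // -[X in X <= _]expRK ler_ln ?posrE ?expR_gt0 //.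
  exact: ltW.
have L0 : 0 < L by rewrite -(pmulr_lgt0 _ theta0); lra.
(* After [N0] steps the spare units exceed [- ln V], the deficit at the root. The successor makes
   [N0] positive. *)
exists (Num.bound `|ln V|).+1 => // N _ T G GV Gchildren.
set c := r%:R `^ g3.
(* Chosen so that [r^g5 * d] and [c * k] both equal half of [r^g4]. *)
pose d := r%:R `^ (g4 - g5) / 2; pose k := r%:R `^ (g4 - g3) / 2.
have c1 : 1 < c by rewrite -ltr_ln ?posrE ?powR_gt0 // ln1 ln_powR mulr_gt0.
have d0 : 0 < d by rewrite divr_gt0 ?powR_gt0.
have k0 : 0 < k by rewrite divr_gt0 ?powR_gt0.
pose f Q := node_content G r%:R g4 (N - height G Q) Q.
have /fin_all_exists[S SP] Q : exists S : {set T},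
    Q \in nodes G -> (height G Q < N)%N ->
    [/\ S \subset children G Q, S != set0,
      c <= #|S|%:R -> {in S, forall Q', f Q * d <= f Q'}
    & #|S|%:R < c -> {in S, forall Q', f Q * k <= f Q'}].
  have [QG|_] := boolP (Q \in nodes G); last by exists set0.
  have [QN|_] := ltnP (height G Q) N; last by exists set0.
  have [| | | | | | | | |S HS] := @many_large_or_one_larger _ _ (children G Q) f
    (r%:R `^ g4) (r%:R `^ g5) c (f Q) d k; last by exists S.
  - by move=> ?; apply: node_content_ge0.
  - by have [Q' ?] := children_neq0 G Q QG QN; apply/set0Pn; exists Q'.
  - exact: node_content_ge0.
  - exact: ltW.
  - exact: c1.
  - exact: Gchildren.
  - by rewrite mulrA -powRD ?rV0 ?implybT // addrC subrK.
  - by rewrite mulrA -powRD ?rV0 ?implybT // addrC subrK.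
  (* As [Q] is not a leaf, its distance to the leaves is a successor and the recursion unfolds
     once. *)
  rewrite /f -(subnSK QN); apply: le_trans (node_content_children _ _ _ r0 _ _) _.
  by apply: ler_sum => Q' /mem_children[_ _ _ ->].
have subS Q (QG : Q \in nodes G) (QN : (height G Q < N)%N) :
  S Q \subset children G Q by have [] := SP Q QG QN.
have S0 Q (QG : Q \in nodes G) (QN : (height G Q < N)%N) :
  S Q != set0 by have [] := SP Q QG QN.
exists (selected_tree G S subS S0); first exact: subtree_selected.
move=> Q sQ NQ; have [Q' Q'G hQ'|Q' Q'G hQ'|ah bound] :=
  selected_tree_bound G S subS S0 f c d k V (ltW d0) (ltW k0) _ _ Q sQ.
- rewrite /f hQ' subn0; apply: le_trans GV _.
  exact: content_le_node_content.
- by have [] := SP Q' Q'G hQ'.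
rewrite /has_fertile_ancestry card_ancestry //.
rewrite /= in NQ *; move: ah bound; set a := #|_|; set n := height G Q in NQ * => an bound.
have lnd : ln d = (g4 - g5) * L - ln 2 by rewrite ln_div ?posrE ?powR_gt0 // ln_powR.
have lnk : ln k = (g4 - g3) * L - ln 2 by rewrite ln_div ?posrE ?powR_gt0 // ln_powR.
(* The content never exceeds 1, so the logarithm of the accumulated lower bound is at most 0. *)
have := ln_le0 (le_trans bound (node_content_le1 _ _ _ _ _)).
rewrite !lnM ?posrE ?mulr_gt0 ?exprn_gt0 // !lnXn //.
rewrite -[ln d *+ _]mulr_natl -[ln k *+ _]mulr_natl natrB // lnd lnk.
have nV : - ln V < n%:R.
  apply: le_lt_trans (ler_norm _) _; rewrite normrN.
  by apply: lt_trans (archi_boundP (normr_ge0 _)) _; rewrite ltr_nat.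
move=> bound'; exact: fertile_density (ltW eps0) hg34 hg45 (ler0n _ _) L0 hL nV bound'.
Qed.
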